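(* Let $\alpha=\pi/(\pi-2)$ and $\beta=3$. For every $x\in[-\pi/2,\pi/2]$, $$\frac{\cos x+\alpha-1}{\alpha}\le \frac{\sin x}{x}\le \frac{\cos x+\beta-1}{\beta}.$$ The constants $\alpha$ and $\beta$ are best possible. Equality holds in the lower bound for $x\in\{-\pi/2,0,\pi/2\}$, and equality holds in the upper bound for $x=0$.
   Context: The function $\frac{\sin x}{x}$ is given its limit value $1$ at $x=0$. ''Best possible'' means: among positive constants, $\alpha$ cannot be replaced by any larger number in the left inequality, and $\beta$ cannot be replaced by any smaller positive number in the right inequality, if the inequality is to hold for all $x\in[-\pi/2,\pi/2]$. *)

(* Defs.v *)
From Stdlib Require Import Reals.
Open Scope R_scope.

Definition sinc (x : R) : R := if Req_EM_T x 0 then 1 else sin x / x.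

Definition cos_mean (c x : R) : R := (cos x + c - 1) / c.

Definition lower_bound_holds (a : R) : Prop :=
  forall x : R, - PI / 2 <= x <= PI / 2 -> cos_mean a x <= sinc x.

Definition upper_bound_holds (b : R) : Prop :=
  forall x : R, - PI / 2 <= x <= PI / 2 -> sinc x <= cos_mean b x.

(* Main.v *)
(** Both bounds are even in [x], so take [0 < x <= PI / 2]. The upper bound, and the
    optimality of [3], follow from Taylor polynomials at [0]; the optimality of [alpha]
    is seen at [x = PI / 2].

    For the lower bound put [h x = alpha sin x - x (cos x + alpha - 1)], which vanishes
    at [0] and, by the choice of [alpha], at [PI / 2]. Since
    [h' x = (1 - cos x) (x cot (x / 2) - (alpha - 1))] and [x cot (x / 2)] is decreasing,
    [h'] can only change sign from positive to negative, so [h] cannot dip below [0]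
    between its two zeros. *)
Require Import Defs.
From Stdlib Require Import Reals Lra Psatz.
From Coquelicot Require Import Coquelicot.
Open Scope R_scope.

Lemma MVT_is_derive (f f' : R -> R) (a b : R) :
  a < b -> (forall c, a <= c <= b -> is_derive f c (f' c)) ->
  exists c, f b - f a = f' c * (b - a) /\ a < c < b.
Proof.
  intros ab df. apply MVT_cor2; [exact ab|].
  intros c hc. apply is_derive_Reals, df, hc.
Qed.

Lemma sin_le_taylor5 (x : R) : 0 <= x <= PI -> sin x <= x - x ^ 3 / 6 + x ^ 5 / 120.
Proof.
  intros [h0 h1]. destruct (sin_bound x 0 h0 h1) as [_ h].
  unfold sin_approx, sin_term in h; simpl in h. simpl; lra.
Qed.

Lemma sin_ge_taylor3 (x : R) : 0 <= x <= PI -> x - x ^ 3 / 6 <= sin x.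
Proof.
  intros [h0 h1]. destruct (sin_bound x 0 h0 h1) as [h _].
  unfold sin_approx, sin_term in h; simpl in h. simpl; lra.
Qed.

Lemma cos_le_taylor4 (x : R) :
  - PI / 2 <= x <= PI / 2 -> cos x <= 1 - x ^ 2 / 2 + x ^ 4 / 24.
Proof.
  intros [h0 h1].
  destruct (cos_bound x 0 ltac:(lra) ltac:(lra)) as [_ h].
  unfold cos_approx, cos_term in h; simpl in h. simpl; lra.
Qed.

Lemma cos_ge_taylor6 (x : R) :
  - PI / 2 <= x <= PI / 2 -> 1 - x ^ 2 / 2 + x ^ 4 / 24 - x ^ 6 / 720 <= cos x.
Proof.
  intros [h0 h1].
  (* Index [1] yields the lower partial sum of degree 6. Index [0] would stop at degree 2, which is
     too weak against the degree 5 bound on [sin]. *)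
  destruct (cos_bound x 1 ltac:(lra) ltac:(lra)) as [h _].
  unfold cos_approx, cos_term in h; simpl in h. simpl; lra.
Qed.

Lemma sinc_0 : sinc 0 = 1.
Proof. unfold sinc. destruct (Req_EM_T 0 0); [reflexivity | lra]. Qed.

Lemma sinc_neq0 (x : R) : x <> 0 -> sinc x = sin x / x.
Proof. intros hx. unfold sinc. destruct (Req_EM_T x 0); [contradiction | reflexivity]. Qed.

Lemma sinc_opp (x : R) : sinc (- x) = sinc x.
Proof.
  destruct (Req_dec x 0) as [-> | hx]; [now rewrite Ropp_0|].
  rewrite !sinc_neq0, sin_neg by lra. field; exact hx.
Qed.

Lemma cos_mean_opp (c x : R) : cos_mean c (- x) = cos_mean c x.
Proof. unfold cos_mean. now rewrite cos_neg. Qed.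

Lemma cos_mean_0 (c : R) : c <> 0 -> cos_mean c 0 = 1.
Proof. intros hc. unfold cos_mean. rewrite cos_0. field; exact hc. Qed.

(** Multiplying by [c * x > 0] removes both divisions, leaving a form suited to polynomial
    estimates. *)
Lemma sinc_le_cos_mean_iff (c x : R) :
  0 < c -> 0 < x -> sinc x <= cos_mean c x <-> c * sin x <= x * (cos x + c - 1).
Proof.
  intros hc hx. rewrite sinc_neq0 by lra. unfold cos_mean.
  replace (sin x / x) with (c * sin x / (c * x)) by (field; lra).
  replace ((cos x + c - 1) / c) with (x * (cos x + c - 1) / (c * x)) by (field; lra).
  assert (hcx : 0 < / (c * x)) by (apply Rinv_0_lt_compat, Rmult_lt_0_compat; lra).
  unfold Rdiv. split; intros h.
  - now apply Rmult_le_reg_r in h.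
  - apply Rmult_le_compat_r; lra.
Qed.

Lemma cos_mean_le_sinc_iff (c x : R) :
  0 < c -> 0 < x -> cos_mean c x <= sinc x <-> x * (cos x + c - 1) <= c * sin x.
Proof.
  intros hc hx. rewrite sinc_neq0 by lra. unfold cos_mean.
  replace (sin x / x) with (c * sin x / (c * x)) by (field; lra).
  replace ((cos x + c - 1) / c) with (x * (cos x + c - 1) / (c * x)) by (field; lra).
  assert (hcx : 0 < / (c * x)) by (apply Rinv_0_lt_compat, Rmult_lt_0_compat; lra).
  unfold Rdiv. split; intros h.
  - now apply Rmult_le_reg_r in h.
  - apply Rmult_le_compat_r; lra.
Qed.

(** With the Taylor bounds inserted, right side minus left side is at least
    [x ^ 5 * (12 - x ^ 2) / 720], and [PI <= 4] gives [x <= 2]. *)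
Lemma three_sin_le (x : R) : 0 <= x <= PI / 2 -> 3 * sin x <= x * (cos x + 3 - 1).
Proof.
  intros hx. assert (hpi := PI_4).
  assert (hs := sin_le_taylor5 x ltac:(lra)).
  assert (hc := cos_ge_taylor6 x ltac:(lra)).
  assert (h : x * (1 - x ^ 2 / 2 + x ^ 4 / 24 - x ^ 6 / 720) <= x * cos x)
    by (apply Rmult_le_compat_l; lra).
  assert (h5 : 0 <= x ^ 5 * (12 - x ^ 2)).
  { apply Rmult_le_pos; [apply pow_le; lra | nra]. }
  nra.
Qed.

(* The quotient is [x * cot (x / 2)], written without half angles. *)
Lemma x_cot_half_decreasing (x y : R) :
  0 < x -> x < y -> y < PI ->
  y * (1 + cos y) / sin y < x * (1 + cos x) / sin x.
Proof.
  intros hx hxy hy.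
  destruct (MVT_is_derive (fun t => t * (1 + cos t) / sin t)
    (fun t => (1 + cos t) * (sin t - t) / (sin t) ^ 2) x y hxy) as (c & hc & hcr).
  - intros c hc. assert (hs : 0 < sin c) by (apply sin_gt_0; lra).
    auto_derive; [lra|].
    (* The quotient rule produces [- c * (sin c ^ 2 + cos c ^ 2 + cos c)] in the numerator; the
       Pythagorean identity turns it into [- c * (1 + cos c)], so [1 + cos c] factors out. *)
    assert (e := sin2_cos2 c). unfold Rsqr in e.
    apply (Rmult_eq_reg_r (sin c ^ 2)); [|nra].
    field_simplify; [|lra..].
    replace (cos c ^ 2) with (1 - sin c ^ 2) by lra.
    ring_simplify. nra.
  - simpl in hc.
    assert (hs : 0 < sin c) by (apply sin_gt_0; lra).
    assert (hsc : sin c < c) by (apply sin_lt_x; lra).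
    assert (hcos : 0 < 1 + cos c).
    { assert (h := cos_decreasing_1 c PI). rewrite cos_PI in h.
      assert (-1 < cos c) by (apply h; lra). lra. }
    assert (hneg : 0 < (1 + cos c) * (c - sin c) / sin c ^ 2 * (y - x)).
    { apply Rmult_lt_0_compat; [|lra].
      apply Rdiv_lt_0_compat; [nra | apply pow_lt; lra]. }
    simpl in hneg. unfold Rdiv in *. nra.
Qed.

(** Since [(1 - cos x) * (1 + cos x) = sin x ^ 2], the factor [1 - cos x] can be pulled out of the
    derivative used for the lower bound, leaving its sign to the monotone quotient. *)
Lemma x_sin_eq_cot_half (x : R) :
  sin x <> 0 -> x * sin x = (1 - cos x) * (x * (1 + cos x) / sin x).
Proof.
  intros hs. assert (e := sin2_cos2 x). unfold Rsqr in e.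
  apply (Rmult_eq_reg_r (sin x)); [|exact hs].
  field_simplify; [|exact hs].
  replace (sin x ^ 2) with (1 - cos x ^ 2) by lra. ring.
Qed.

Lemma lower_bound_cross (x : R) (alpha := PI / (PI - 2)) :
  0 < x <= PI / 2 -> x * (cos x + alpha - 1) <= alpha * sin x.
Proof.
  intros hx. assert (hpi := PI2_1).
  destruct (Rle_lt_dec (x * (cos x + alpha - 1)) (alpha * sin x)) as [h|h]; [exact h|].
  exfalso.
  set (f := fun t => alpha * sin t - t * (cos t + alpha - 1)).
  assert (df : forall t, is_derive f t (t * sin t - (alpha - 1) * (1 - cos t))).
  { intros t. unfold f. auto_derive; [exact I | ring]. }
  assert (f0 : f 0 = 0) by (unfold f; rewrite sin_0; ring).
  assert (f1 : f (PI / 2) = 0).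
  { unfold f, alpha. rewrite sin_PI2, cos_PI2. field; lra. }
  assert (fx : f x < 0) by (unfold f; lra).
  assert (hx1 : x < PI / 2).
  { destruct (Req_dec x (PI / 2)) as [e|e]; [rewrite e in fx|]; lra. }
  (* A negative value between two zeros forces a negative slope at some [c < x] and a positive slope
     at some [d > x]. After division by [1 - cos], the quotient is below [alpha - 1] at [c] and
     above it at [d], although it decreases. *)
  destruct (MVT_is_derive f _ 0 x (proj1 hx) (fun t _ => df t)) as (c & hc & hc').
  destruct (MVT_is_derive f _ x (PI / 2) hx1 (fun t _ => df t)) as (d & hd & hd').
  cbv beta in hc, hd.
  assert (sc : 0 < sin c) by (apply sin_gt_0; lra).
  assert (sd : 0 < sin d) by (apply sin_gt_0; lra).
  assert (ec := sin2_cos2 c). assert (ed := sin2_cos2 d). unfold Rsqr in ec, ed.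
  rewrite x_sin_eq_cot_half in hc by lra.
  rewrite x_sin_eq_cot_half in hd by lra.
  assert (hcd := x_cot_half_decreasing c d ltac:(lra) ltac:(lra) ltac:(lra)).
  set (qc := c * (1 + cos c) / sin c) in *.
  set (qd := d * (1 + cos d) / sin d) in *.
  assert (kc : 0 < 1 - cos c) by nra.
  assert (kd : 0 < 1 - cos d) by nra.
  assert (hqc : qc < alpha - 1).
  { apply Rnot_le_lt; intros hq.
    assert (0 <= (1 - cos c) * (qc - (alpha - 1)) * (x - 0))
      by (apply Rmult_le_pos; [apply Rmult_le_pos|]; lra).
    nra. }
  assert (hqd : alpha - 1 < qd).
  { apply Rnot_le_lt; intros hq.
    assert (0 <= (1 - cos d) * (alpha - 1 - qd) * (PI / 2 - x))
      by (apply Rmult_le_pos; [apply Rmult_le_pos|]; lra).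
    nra. }
  lra.
Qed.

Lemma sinc_bounds (x : R) :
  - PI / 2 <= x <= PI / 2 -> cos_mean (PI / (PI - 2)) x <= sinc x <= cos_mean 3 x.
Proof.
  assert (hpi := PI2_1).
  assert (ha : 0 < PI / (PI - 2)) by (apply Rdiv_lt_0_compat; lra).
  assert (pos : forall y, 0 < y <= PI / 2 ->
    cos_mean (PI / (PI - 2)) y <= sinc y <= cos_mean 3 y).
  { intros y hy. split.
    - apply cos_mean_le_sinc_iff; [lra | lra | now apply lower_bound_cross].
    - apply sinc_le_cos_mean_iff; [lra | lra | apply three_sin_le; lra]. }
  intros hx. destruct (Rtotal_order x 0) as [h | [-> | h]].
  - rewrite <- sinc_opp, <- !(cos_mean_opp _ x). apply pos; lra.
  - rewrite sinc_0, !cos_mean_0; lra.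
  - apply pos; lra.
Qed.

Lemma cos_mean_alpha_PI2 : cos_mean (PI / (PI - 2)) (PI / 2) = sinc (PI / 2).
Proof.
  assert (hpi := PI2_1).
  rewrite sinc_neq0 by lra. unfold cos_mean. rewrite sin_PI2, cos_PI2. field; lra.
Qed.

Lemma lower_constant_optimal (a : R) : PI / (PI - 2) < a -> ~ lower_bound_holds a.
Proof.
  intros ha hl. assert (hpi := PI2_1).
  assert (h0 : 0 < PI / (PI - 2)) by (apply Rdiv_lt_0_compat; lra).
  specialize (hl (PI / 2) ltac:(lra)).
  apply cos_mean_le_sinc_iff in hl; [|lra|lra].
  (* At [PI / 2] the inequality becomes [PI / 2 * (a - 1) <= a], that is, [a * (PI - 2) <= PI]. *)
  rewrite sin_PI2, cos_PI2 in hl.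
  assert (h : PI / (PI - 2) * (PI - 2) < a * (PI - 2))
    by (apply Rmult_lt_compat_r; lra).
  replace (PI / (PI - 2) * (PI - 2)) with PI in h by (field; lra).
  lra.
Qed.

Lemma upper_constant_optimal (b : R) : 0 < b < 3 -> ~ upper_bound_holds b.
Proof.
  intros hb hu. assert (hpi := PI2_1).
  (* By the Taylor bounds the inequality at [x] forces [3 - x ^ 2 / 4 <= b]. *)
  set (x := Rmin 1 (3 - b)).
  assert (hx0 : 0 < x) by (apply Rmin_glb_lt; lra).
  assert (hx1 : x <= 1) by apply Rmin_l.
  assert (hxb : x <= 3 - b) by apply Rmin_r.
  specialize (hu x ltac:(lra)).
  apply sinc_le_cos_mean_iff in hu; [|lra|lra].
  assert (hs := sin_ge_taylor3 x ltac:(lra)).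
  assert (hc := cos_le_taylor4 x ltac:(lra)).
  assert (h1 : b * (x - x ^ 3 / 6) <= b * sin x) by (apply Rmult_le_compat_l; lra).
  assert (h2 : x * cos x <= x * (1 - x ^ 2 / 2 + x ^ 4 / 24))
    by (apply Rmult_le_compat_l; lra).
  (* The choice of [x] gives [x ^ 2 <= x <= 3 - b], hence [x ^ 2 / 4 < 3 - b]. *)
  assert (h3 : 0 < x ^ 3 * (3 - x ^ 2 / 4 - b))
    by (apply Rmult_lt_0_compat; [apply pow_lt; lra | nra]).
  nra.
Qed.

Theorem theorem1p6 :
  let alpha := PI / (PI - 2) in
  let beta := 3 in
  (forall x : R, - PI / 2 <= x <= PI / 2 ->
     cos_mean alpha x <= sinc x <= cos_mean beta x) /\
  (forall a : R, alpha < a -> ~ lower_bound_holds a) /\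
  (forall b : R, 0 < b < beta -> ~ upper_bound_holds b) /\
  (forall x : R, x = - PI / 2 \/ x = 0 \/ x = PI / 2 ->
     cos_mean alpha x = sinc x) /\
  sinc 0 = cos_mean beta 0.
Proof.
  intros alpha beta. assert (hpi := PI2_1).
  assert (ha : 0 < alpha) by (apply Rdiv_lt_0_compat; lra).
  split; [exact sinc_bounds|].
  split; [exact lower_constant_optimal|].
  split; [exact upper_constant_optimal|].
  split.
  - intros x [-> | [-> | ->]].
    + replace (- PI / 2) with (- (PI / 2)) by lra.
      rewrite cos_mean_opp, sinc_opp. exact cos_mean_alpha_PI2.
    + rewrite sinc_0, cos_mean_0; lra.
    + exact cos_mean_alpha_PI2.
  - rewrite sinc_0, cos_mean_0; unfold beta; lra.
Qed.
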